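(* Let $\mathcal{A}$ be a cluster algebra of rank $2$. Then $\mathcal{A}$ is unistructural.
   Context: Cluster algebras. $Q$ denotes a finite connected quiver without loops or 2-cycles, with points $1,\dots,n$, and $\mathbf{x}=\{x_1,\dots,x_n\}$ is a set of $n$ variables (a cluster), with $x_i$ attached to the point $i$. The pair $(\mathbf{x},Q)$ is a seed and $\mathcal{F}=\mathbb{Q}(x_1,\dots,x_n)$ is the ambient field. The mutation $\mu_k(\mathbf{x},Q)=(\mathbf{x}',Q')$ is defined as follows: $Q'$ is obtained from $Q$ by inserting a new arrow $i\to j$ for each path $i\to k\to j$, reversing all arrows incident to $k$, and deleting all ensuing 2-cycles; and $\mathbf{x}'=(\mathbf{x}\setminus\{x_k\})\cup\{x_k'\}$ with $x_k'=\big(\prod_{i\to k}x_i+\prod_{k\to i}x_i\big)/x_k$ (products over arrows entering and leaving $k$). Clusters are the sets $\mathbf{x}_\alpha$ in the seeds obtained from $(\mathbf{x},Q)$ by iterated mutations; cluster variables are the elements of $\mathcal{X}=\bigcup_\alpha\mathbf{x}_\alpha$; the cluster algebra $\mathcal{A}(\mathbf{x},Q)$ is the $\mathbb{Z}$-subalgebra of $\mathcal{F}$ generated by $\mathcal{X}$. Its rank is $n$; in rank $2$ the quiver $Q$ consists of two points and some number $r$ of arrows from one to the other. Unistructurality. Let $(\mathbf{x}_\alpha)_{\alpha\in\Gamma_0}$ be the family of clusters of $\mathcal{A}=\mathcal{A}(\mathbf{x},Q)$, where $\Gamma_0$ is the vertex set of the exchange graph $\Gamma$ (vertices: seeds/clusters,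 edges: mutations). $\mathcal{A}$ is unistructural if for any subset $\mathbf{x}'\subseteq\mathcal{X}$ and quiver $Q'$ such that the pair $(\mathbf{x}',Q')$ generates by mutation the same set $\mathcal{X}$ of cluster variables, the exchange graphs and the sets of clusters of $\mathcal{A}$ and $\mathcal{A}(\mathbf{x}',Q')$ are the same; i.e. if $(\mathbf{x}'_\beta)_{\beta\in\Gamma'_0}$ is the family of clusters generated by $(\mathbf{x}',Q')$, indexed by the vertices of its exchange graph $\Gamma'$, then $\mathcal{X}=\bigcup_{\beta\in\Gamma'_0}\mathbf{x}'_\beta$ implies that $\Gamma=\Gamma'$ and there is a permutation $\sigma$ of $\Gamma_0$ with $\mathbf{x}_\alpha=\mathbf{x}'_{\sigma(\alpha)}$ for all $\alpha$. *)

(* Defs.v *)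
From mathcomp Require Import all_boot all_order all_fingroup all_algebra.
From mathcomp Require Import finmap mpoly.

Set Implicit Arguments.
Unset Strict Implicit.
Unset Printing Implicit Defensive.

Import GRing.Theory.
Local Open Scope ring_scope.

(* A finite quiver with points 'I_n is given by its arrow multiplicities:
   Q i j is the number of arrows i -> j. *)
Notation quiver n := 'M[nat]_n.

Section Quivers.
Variable n : nat.
Implicit Types (Q : quiver n) (k : 'I_n).

Definition loopless Q := [forall i, Q i i == 0%N].

Definition no_2cycle Q := [forall i, forall j, (Q i j == 0%N) || (Q j i == 0%N)].

Definition connected_quiver Q :=
  [forall i, forall j,
     connect (fun a b => (0 < Q a b)%N || (0 < Q b a)%N) i j].

Definition is_quiver Q := [&& loopless Q, no_2cycle Q & connected_quiver Q].

Definition insert_arrows k Q : quiver n :=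
  \matrix_(i, j) (Q i j + Q i k * Q k j)%N.

Definition reverse_at k Q : quiver n :=
  \matrix_(i, j) if (i == k) || (j == k) then Q j i else Q i j.

(* The subtraction is truncated: a maximal set of disjoint 2-cycles between
   i and j is deleted. *)
Definition delete_2cycles Q : quiver n := \matrix_(i, j) (Q i j - Q j i)%N.

Definition quiver_mutation k Q : quiver n :=
  delete_2cycles (reverse_at k (insert_arrows k Q)).

End Quivers.

Section Seeds.
Variable F : fieldType.

(* The variable [svar t i] is attached to the point i of [squiver t]. *)
Record seed n := Seed { svar : {ffun 'I_n -> F}; squiver : quiver n }.

Definition alg_independent n (x : 'I_n -> F) :=
  forall p : {mpoly rat[n]}, mmap (@ratr F) x p = 0 -> p = 0.

Definition is_seed n (t : seed n) :=
  alg_independent (svar t) /\ is_quiver (squiver t).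

Definition exchange_var n (k : 'I_n) (t : seed n) : F :=
  (\prod_i svar t i ^+ squiver t i k + \prod_i svar t i ^+ squiver t k i)
    / svar t k.

Definition mutation n (t : seed n) (k : 'I_n) : seed n :=
  Seed [ffun i => if i == k then exchange_var k t else svar t i]
       (quiver_mutation k (squiver t)).

Definition mutation_equiv n (s t : seed n) :=
  exists ks : seq 'I_n, t = foldl (@mutation n) s ks.

Definition cluster n (t : seed n) : {fset F} :=
  [fset svar t i | i in 'I_n]%fset.

Definition cluster_variable n (s : seed n) (z : F) :=
  exists2 t, mutation_equiv s t & z \in cluster t.

(* The vertices of the exchange graph of [s] are the seeds mutation equivalent
   to [s], two of them being the same vertex when they differ only by the
   numbering of the points; the quotient is handled as a setoid. *)
Definition same_vertex n (t u : seed n) :=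
  exists p : 'S_n,
    (forall i, svar u i = svar t (p i)) /\
    (forall i j, squiver u i j = squiver t (p i) (p j)).

Definition adjacent n (t u : seed n) :=
  exists k, same_vertex (mutation t k) u.

Definition exchange_graph_iso n m (s : seed n) (s' : seed m)
    (sigma : seed n -> seed m) :=
  [/\ forall t, mutation_equiv s t -> mutation_equiv s' (sigma t),
      forall t u, mutation_equiv s t -> mutation_equiv s u ->
        (same_vertex t u <-> same_vertex (sigma t) (sigma u)),
      forall t', mutation_equiv s' t' ->
        exists2 t, mutation_equiv s t & same_vertex (sigma t) t'
    & forall t u, mutation_equiv s t -> mutation_equiv s u ->
        (adjacent t u <-> adjacent (sigma t) (sigma u))].

(* The competing seed [s'] may have any rank m. The bijection sigma identifies
   the exchange graphs of [s] and [s'] and matches the two families of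
   clusters. *)
Definition unistructural n (s : seed n) :=
  forall m (s' : seed m), is_seed s' ->
    (forall z, z \in cluster s' -> cluster_variable s z) ->
    (forall z, cluster_variable s z <-> cluster_variable s' z) ->
    exists2 sigma : seed n -> seed m,
      exchange_graph_iso s s' sigma
      & forall t, mutation_equiv s t -> cluster t = cluster (sigma t).

End Seeds.

Definition ambient_field n : fieldType := {fraction {mpoly rat[n]}}.

(* The seed (x, Q) with x the indeterminates of Q(x_1, ..., x_n). *)
Definition initial_seed n (Q : quiver n) : seed (ambient_field n) n :=
  Seed [ffun i : 'I_n => tofrac ('X_i : {mpoly rat[n]}) : ambient_field n] Q.

(* Main.v *)
(** Evaluate the cluster variables at points with positive rational coordinates.
    Mutation is invertible on positive values, so for any cluster {a, b} of the
    rank 2 seed there is a point where a = 1/2 and b = 1. There every cluster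
    variable other than a, b and b' = (a^r + 1) / b takes a value at least 2: for
    r > 1 the values grow monotonically on both sides of {a, b}, for r = 1 the
    sequence of cluster variables has period 5.

    Let {a, y} be the competing cluster, with r' arrows, and y' = (a^r' + 1) / y.
    Since y y' = a^r' + 1 has a value less than 2, and y, y' take values at least
    1, both are in {b, b'}. They are distinct, so a^r' + 1 = y y' = b b' = a^r + 1
    and r' = r. Hence the competing seed is, up to numbering of the points and
    reversal of all arrows, a seed of the given algebra, and both operations
    commute with mutation. *)
Require Import Defs.
From mathcomp Require Import all_boot all_order all_fingroup all_algebra.
From mathcomp Require Import finmap mpoly.
From mathcomp Require Import ring lra zify.

Set Implicit Arguments.
Unset Strict Implicit.
Unset Printing Implicit Defensive.

Import Order.TTheory GRing.Theory Num.Theory.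
Local Open Scope ring_scope.

(** * Relabelling seeds *)

Section Relabelling.
Variables (F : fieldType) (n : nat).
Implicit Types (t u : seed F n) (p : 'S_n) (b : bool) (k : 'I_n).

Lemma seedP t u :
  svar t =1 svar u -> squiver t =2 squiver u -> t = u.
Proof.
case: t u => [x Q] [x' Q'] /= /ffunP -> eqQ.
by congr Seed; apply/matrixP.
Qed.

(** The flag [b] reverses all arrows: a cluster does not determine the orientation of its quiver, so
    a competing seed is matched only up to reversal. *)
Definition relabel p b t : seed F n :=
  Seed [ffun i => svar t (p i)]
    (\matrix_(i, j) if b then squiver t (p j) (p i) else squiver t (p i) (p j)).

Lemma relabelV p b t : relabel p^-1%g b (relabel p b t) = t.
Proof.
apply: seedP => [i|i j]; first by rewrite !ffunE permKV.
by rewrite !mxE !permKV; case: b.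
Qed.

(** Reversing all arrows swaps the two monomials of the exchange relation and commutes with each
    stage of quiver mutation. *)
Lemma relabel_mutation p b t k :
  relabel p b (mutation t (p k)) = mutation (relabel p b t) k.
Proof.
apply: seedP => [i|i j] /=; last first.
  rewrite !mxE !(inj_eq perm_inj).
  by case: b => //; case: (i == k); case: (j == k);
    congr (_ + _ - (_ + _))%N; exact: mulnC.
rewrite !ffunE (inj_eq perm_inj); case: ifP => // _.
rewrite /exchange_var /= ffunE; congr (_ / _).
have reindexP (G : 'I_n -> nat) :
    \prod_i svar t i ^+ G i = \prod_i svar (relabel p b t) i ^+ G (p i).
  by rewrite (reindex_inj (@perm_inj _ p)); apply: eq_bigr => j _; rewrite ffunE.
rewrite (reindexP (fun i => squiver t i (p k))) (reindexP (squiver t (p k))).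
case: b reindexP => _; [rewrite addrC|]; congr (_ + _);
  by apply: eq_bigr => j _; rewrite mxE.
Qed.

Lemma relabel_foldl p b t ks :
  relabel p b (foldl (@mutation F n) t (map p ks))
  = foldl (@mutation F n) (relabel p b t) ks.
Proof. by elim: ks t => //= k ks IH t; rewrite IH relabel_mutation. Qed.

Lemma relabel_equiv p b t u :
  mutation_equiv t u -> mutation_equiv (relabel p b t) (relabel p b u).
Proof.
case=> ks ->; exists (map (p^-1)%g ks); rewrite -relabel_foldl -map_comp.
by rewrite [map _ _](@eq_map _ _ _ id) ?map_id // => k /=; rewrite permKV.
Qed.

Lemma relabel_same_vertex p b t u :
  same_vertex t u -> same_vertex (relabel p b t) (relabel p b u).
Proof.
case=> q [eqx eqQ]; exists (p * q * p^-1)%g; split=> [i|i j].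
  by rewrite !ffunE eqx !permM permKV.
by rewrite !mxE !permM !permKV !eqQ.
Qed.

Lemma relabel_same_vertexE p b t u :
  same_vertex t u <-> same_vertex (relabel p b t) (relabel p b u).
Proof.
split; first exact: relabel_same_vertex.
by move/(relabel_same_vertex p^-1 b); rewrite !relabelV.
Qed.

Lemma relabel_adjacentE p b t u :
  adjacent t u <-> adjacent (relabel p b t) (relabel p b u).
Proof.
split=> [[k tku]|[k tku]].
  exists ((p^-1)%g k); rewrite -relabel_mutation permKV.
  exact: relabel_same_vertex.
exists (p k); apply/(relabel_same_vertexE p b).
by rewrite relabel_mutation.
Qed.

Lemma relabel_cluster p b t : cluster (relabel p b t) = cluster t.
Proof.
apply/fsetP=> z; apply/imfsetP/imfsetP => /= [[i _ ->]|[i _ ->]].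
  by exists (p i); rewrite ?ffunE.
by exists ((p^-1)%g i); rewrite ?ffunE ?permKV.
Qed.

Lemma mutation_equiv_refl t : mutation_equiv t t.
Proof. by exists [::]. Qed.

Lemma mutation_equiv_mut t u k :
  mutation_equiv t u -> mutation_equiv t (mutation u k).
Proof. by case=> ks ->; exists (rcons ks k); rewrite foldl_rcons. Qed.

Lemma mutation_equiv_trans t u v :
  mutation_equiv t u -> mutation_equiv u v -> mutation_equiv t v.
Proof. by case=> ks -> [ls ->]; exists (ks ++ ls); rewrite foldl_cat. Qed.

Lemma mutation_equiv_ind (P : seed F n -> Prop) t :
  P t -> (forall u k, P u -> P (mutation u k)) ->
  forall u, mutation_equiv t u -> P u.
Proof.
move=> Pt Pmut u [ks ->]; elim/last_ind: ks => // ks k IH.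
by rewrite foldl_rcons; apply: Pmut.
Qed.

(** The seed [t0] may be any one in the mutation class of [s]: a competing cluster need only
    reappear somewhere in that class. *)
Lemma relabel_iso p b s t0 :
  mutation_equiv s t0 -> mutation_equiv t0 s ->
  exchange_graph_iso s (relabel p b t0) (relabel p b).
Proof.
move=> st0 t0s; split=> [t st|t u _ _|t'|t u _ _].
- exact/relabel_equiv/(mutation_equiv_trans t0s).
- exact: relabel_same_vertexE.
- case=> ks ->; rewrite -relabel_foldl.
  eexists; last by exists 1%g; split=> *; rewrite ?perm1.
  by apply: (mutation_equiv_trans st0); eexists.
- exact: relabel_adjacentE.
Qed.

End Relabelling.

(** * Transcendence degree *)

Lemma ratr_tofrac n (c : rat) :
  ratr c = tofrac c%:MP :> ambient_field n.
Proof.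
rewrite -(fmorph_eq_rat
  (@tofrac _ \o @mpolyC n rat : {rmorphism rat -> ambient_field n})).
by [].
Qed.

(* [ratr] is a canonical morphism only into a [numFieldType], which a fraction
   field is not. *)
Lemma mmap_ratr n m (y : 'I_m -> ambient_field n) p :
  mmap (@ratr (ambient_field n)) y p = mmap (@tofrac _ \o @mpolyC n rat) y p.
Proof. by apply: eq_bigr => k _; rewrite ratr_tofrac. Qed.

Lemma frac_representation (R : idomainType) (f : {fraction R}) :
  exists2 pq : R * R, pq.2 != 0 & f = tofrac pq.1 / tofrac pq.2.
Proof.
elim/quotW: f => x; exists (\n_x, \d_x); first exact: denom_ratioP.
apply/(canRL (mulfK _)); first by rewrite tofrac_eq0 denom_ratioP.
rewrite /tofrac; unlock FracField.tofrac => /=.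
rewrite -[LHS]FracField.pi_mul; apply/eqmodP => /=.
by rewrite FracField.equivfE /FracField.mulf;
  rewrite !numden_Ratio ?oner_neq0 ?mulf_neq0 ?denom_ratioP ?oner_neq0 // !mulr1 mulrC.
Qed.

(** [msize] is the degree plus one, but 0 for the zero polynomial; bounds by successors make degrees
    add in both cases. *)
Lemma msize_mul_le n (p q : {mpoly rat[n]}) k l :
  (msize p <= k.+1)%N -> (msize q <= l.+1)%N -> (msize (p * q) <= (k + l).+1)%N.
Proof.
move=> pk ql; have [->|p0] := eqVneq p 0; first by rewrite mul0r msize0.
have [->|q0] := eqVneq q 0; first by rewrite mulr0 msize0.
rewrite msizeM //; have := leq_add pk ql; rewrite addSn addnS.
by case: (_ + _)%N => //= s; rewrite ltnS => /leqW.
Qed.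

Lemma msize_exp_le n (p : {mpoly rat[n]}) k e :
  (msize p <= k.+1)%N -> (msize (p ^+ e) <= (k * e).+1)%N.
Proof.
move=> pk; elim: e => [|e IH]; first by rewrite expr0 msize1.
by rewrite exprS mulnS; apply: msize_mul_le.
Qed.

Lemma msize_prod_le n m (p : 'I_m -> {mpoly rat[n]}) k :
  (forall j, msize (p j) <= k.+1)%N -> (msize (\prod_j p j) <= (m * k).+1)%N.
Proof.
elim: m p => [|m IH] p pk; first by rewrite big_ord0 msize1.
by rewrite big_ord_recl mulSn; apply: msize_mul_le => //; apply: IH.
Qed.

Lemma common_denominator m (R : idomainType) (y : 'I_m -> {fraction R}) :
  exists (p : 'I_m -> R) (q : R), q != 0 /\ forall j, y j = tofrac (p j) / tofrac q.
Proof.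
have [pq pq0 ypq] := fin_all_exists2 (fun j => frac_representation (y j)).
exists (fun j => (pq j).1 * \prod_(i | i != j) (pq i).2), (\prod_i (pq i).2).
have q0 : \prod_i (pq i).2 != 0 by apply/prodf_neq0.
split=> // j; rewrite ypq; apply/eqP.
rewrite (bigD1 j) //= in q0 *; move: q0; rewrite mulf_eq0 => /norP[a0 b0].
by rewrite !tofracM -mulf_div divff ?mulr1 ?tofrac_eq0.
Qed.

Lemma nontrivial_relation (K : fieldType) (I J : finType) (A : I -> J -> K) :
  (#|J| < #|I|)%N ->
  exists2 v : I -> K, exists i, v i != 0 & forall j, \sum_i v i * A i j = 0.
Proof.
move=> ltJI; pose M := \matrix_(i < #|I|, j < #|J|) A (enum_val i) (enum_val j).
have: kermx M != 0.
  rewrite kermx_eq0 /row_free neq_ltn.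
  by rewrite (leq_ltn_trans (rank_leq_col M) ltJI).
case/rowV0Pn => v /sub_kermxP vM v0; exists (fun i => v 0 (enum_rank i)).
  by case/rV0Pn: v0 => i vi; exists (enum_val i); rewrite enum_valK.
move=> j; have := congr1 (fun w : 'rV_#|J| => w 0 (enum_rank j)) vM.
rewrite /= !mxE => vMj; rewrite -[RHS]vMj.
rewrite (reindex_onto enum_val enum_rank) /=; last by move=> i _; rewrite enum_rankK.
by apply: eq_big => i; rewrite ?mxE ?enum_rankK ?enum_valK ?eqxx.
Qed.

(* Counting monomials: for N large, the N^m monomials in y with exponents below
   N, multiplied by q^(m N), are polynomials in n variables of degree O(N). *)
Lemma not_alg_independent n m (y : 'I_m -> ambient_field n) :
  (n < m)%N -> ~ alg_independent y.
Proof.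
move=> ltnm indep.
have [p [q [q0 yE]]] := @common_denominator m {mpoly rat[n]} y.
pose d := (\sum_j msize (p j) + msize q)%N.
have pd j : (msize (p j) <= d.+1)%N.
  by rewrite /d (bigD1 j) //= -addnA; apply/leqW/leq_addr.
have qd : (msize q <= d.+1)%N by apply/leqW/leq_addl.
(* Since [N] exceeds [(m * d).+1 ^ n], the number of coefficients, [D ^ n <= ((m * d).+1 * N) ^ n],
   is less than [N ^ n.+1 <= N ^ m]. *)
pose N := ((m * d).+1 ^ n).+1; pose D := (m * (d * N)).+1.
(* The padding by powers of [q] makes [R e] the monomial in [y] times [q ^+ (N * m)], a factor
   independent of [e]. *)
pose R (e : {ffun 'I_m -> 'I_N}) := \prod_j (p j ^+ e j * q ^+ (N - e j)).
have Rsize e : (msize (R e) <= D)%N.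
  apply: msize_prod_le => j; have -> : (d * N = d * e j + d * (N - e j))%N.
    by rewrite -mulnDr subnKC // ltnW.
  exact: msize_mul_le (msize_exp_le _ _) (msize_exp_le _ _).
have [] := @nontrivial_relation rat {ffun 'I_m -> 'I_N} {ffun 'I_n -> 'I_D}
  (fun e c => (R e)@_[multinom c j : nat | j < n]).
  rewrite !card_ffun !card_ord; apply: leq_ltn_trans (_ : ((m * d).+1 * N) ^ n < _)%N.
    have [->//|n0] := posnP n; rewrite leq_exp2r //.
    by rewrite /D mulnA [leqRHS]mulSn addnC -addn1 leq_add2l.
  rewrite expnMn; apply: leq_trans (_ : N * N ^ n <= _)%N.
    by rewrite ltn_pmul2r ?expn_gt0.
  by rewrite -expnS leq_pexp2l.
move=> v [e0 ve0] vR.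
pose X (e : {ffun 'I_m -> 'I_N}) := [multinom e j : nat | j < m].
have Xinj : injective X.
  move=> e e' /mnmP eqX; apply/ffunP=> j; apply/val_inj.
  by have := eqX j; rewrite !mnmE.
have vR0 : \sum_e v e *: R e = 0.
  apply/mpolyP=> k; rewrite mcoeff0 raddf_sum /=.
  under eq_bigr do rewrite mcoeffZ.
  have [kD|Dk] := ltnP (mdeg k) D.
    have kjD j : (k j < D)%N.
      by apply: leq_ltn_trans kD; rewrite mdegE (bigD1 j) //= leq_addr.
    rewrite -[RHS](vR [ffun j => Ordinal (kjD j)]); apply: eq_bigr => e _.
    congr (_ * _@_ _).
    by apply/mnmP=> j; rewrite mnmE ffunE.
  apply: big1 => e _; rewrite memN_msupp_eq0 ?mulr0 //.
  by apply: msize_mdeg_ge; apply: leq_trans Dk.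
have Rtofrac e : tofrac (R e) = tofrac q ^+ (N * m) * \prod_j y j ^+ e j.
  have -> : tofrac q ^+ (N * m) = \prod_(j < m) tofrac q ^+ N.
    by rewrite prodr_const card_ord exprM.
  rewrite rmorph_prod -big_split /=.
  apply: eq_bigr => j _; rewrite rmorphM !rmorphXn /= yE expr_div_n.
  rewrite mulrCA; congr (_ * _); apply/esym/(canLR (mulfK _)).
    by rewrite expf_neq0 // tofrac_eq0.
  by rewrite -exprD subnK // ltnW.
pose P : {mpoly rat[m]} := \sum_e v e *: 'X_[X e].
have P0 : P = 0.
  apply: indep; apply/eqP.
  have q1 : tofrac q ^+ (N * m) != 0 by rewrite expf_neq0 ?tofrac_eq0.
  rewrite -(mulrI_eq0 _ (mulfI q1)).
  apply/eqP; transitivity (tofrac (\sum_e v e *: R e)); last by rewrite vR0 tofrac0.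
  rewrite mmap_ratr /P !raddf_sum mulr_sumr; apply: eq_bigr => e _ /=.
  rewrite mmapZ mmapX -mul_mpolyC tofracM Rtofrac mulrCA; congr (_ * (_ * _)).
  by apply: eq_bigr => j _; rewrite mnmE.
have := congr1 (fun u : {mpoly rat[m]} => u@_(X e0)) P0.
rewrite /P raddf_sum mcoeff0 /= (bigD1 e0) //= big1 => [|e ne]; rewrite mcoeffZ mcoeffX.
  by rewrite eqxx mulr1 addr0; apply/eqP.
by rewrite (inj_eq Xinj) (negPf ne) mulr0.
Qed.

(** * Values of cluster variables *)

Section Evaluation.
Variables (n : nat) (pt : 'I_n -> rat).
Implicit Types (f g : ambient_field n) (c d : rat).

(** A relation, since a fraction has a value at [pt] only if some representation has a denominator
    that does not vanish there. *)
Definition evaluates f c :=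
  exists p q : {mpoly rat[n]},
    [/\ q.@[pt] != 0, f = tofrac p / tofrac q & c = p.@[pt] / q.@[pt]].

Lemma meval_neq0 (q : {mpoly rat[n]}) : q.@[pt] != 0 -> tofrac q != 0.
Proof. by rewrite tofrac_eq0; apply: contraNneq => ->; rewrite meval0. Qed.

Lemma evaluates_tofrac p : evaluates (tofrac p) p.@[pt].
Proof. by exists p, 1; rewrite meval1 oner_neq0 tofrac1 !divr1. Qed.

Lemma evaluates1 : evaluates 1 1.
Proof. by rewrite -[X in evaluates X]tofrac1 -(meval1 pt); apply: evaluates_tofrac. Qed.

Lemma evaluatesD f g c d :
  evaluates f c -> evaluates g d -> evaluates (f + g) (c + d).
Proof.
move=> [p [q [q0 -> ->]]] [p' [q' [q'0 -> ->]]].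
exists (p * q' + p' * q), (q * q').
by rewrite !mevalD !mevalM mulf_neq0 // !addf_div ?meval_neq0 // tofracD !tofracM.
Qed.

Lemma evaluatesM f g c d :
  evaluates f c -> evaluates g d -> evaluates (f * g) (c * d).
Proof.
move=> [p [q [q0 -> ->]]] [p' [q' [q'0 -> ->]]].
by exists (p * p'), (q * q'); rewrite !mevalM mulf_neq0 // !mulf_div !tofracM.
Qed.

Lemma evaluatesX f c k : evaluates f c -> evaluates (f ^+ k) (c ^+ k).
Proof.
move=> fc; elim: k => [|k IH]; first exact: evaluates1.
by rewrite !exprS; apply: evaluatesM.
Qed.

Lemma evaluatesV f c : c != 0 -> evaluates f c -> evaluates f^-1 c^-1.
Proof.
move=> c0 [p [q [q0 -> cE]]]; exists q, p; rewrite cE !invf_div; split=> //.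
by apply: contraNneq c0 => p0; rewrite cE p0 mul0r.
Qed.

Lemma evaluates_inj f c d : evaluates f c -> evaluates f d -> c = d.
Proof.
move=> [p [q [q0 -> ->]]] [p' [q' [q'0 /eqP + ->]]].
rewrite eqr_div ?meval_neq0 // -!tofracM tofrac_eq => /eqP pq.
by apply/eqP; rewrite eqr_div // -!mevalM pq.
Qed.

Lemma evaluates_neq0 f c : c != 0 -> evaluates f c -> f != 0.
Proof.
move=> c0 fc; apply: contraNneq c0 => f0; apply/eqP/(evaluates_inj fc).
by rewrite f0 -tofrac0 -(meval0 pt); apply: evaluates_tofrac.
Qed.

End Evaluation.

(** * The exchange sequence x_{n+2} x_n = x_{n+1}^r + 1 *)

Fixpoint cseq (K : fieldType) r (a b : K) n :=
  if n is n'.+1 then cseq r b ((b ^+ r + 1) / a) n' else a.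

Lemma cseqSS (K : fieldType) r (a b : K) n :
  cseq r a b n.+2 = (cseq r a b n.+1 ^+ r + 1) / cseq r a b n.
Proof. by elim: n a b => [|n IH] a b //; rewrite /= -IH. Qed.

Lemma cseq_gt0 r (a b : rat) n : 0 < a -> 0 < b -> 0 < cseq r a b n.
Proof.
elim: n a b => //= n IH a b a0 b0; apply: IH => //.
by rewrite divr_gt0 // addr_gt0 ?exprn_gt0.
Qed.

Lemma evaluates_cseq m (pt : 'I_m -> rat) r a b c d n : 0 < c -> 0 < d ->
  evaluates pt a c -> evaluates pt b d -> evaluates pt (cseq r a b n) (cseq r c d n).
Proof.
elim: n a b c d => //= n IH a b c d c0 d0 ac bd; apply: IH => //.
  by rewrite divr_gt0 // addr_gt0 ?exprn_gt0.
apply: evaluatesM; last by apply: evaluatesV => //; rewrite gt_eqF.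
exact: evaluatesD (evaluatesX _ bd) (evaluates1 _).
Qed.

Section RealSequence.
Variable K : realFieldType.
Implicit Types (a b : K).

(** As [b >= 1] and [r >= 2], [b ^+ r >= b ^+ 2 >= a * b]. This step propagates growth along the
    sequence. *)
Lemma cseq_step_ge r a b : (1 < r)%N -> 0 < a -> a <= b -> 1 <= b ->
  b <= (b ^+ r + 1) / a.
Proof.
move=> r1 a0 ab b1; rewrite ler_pdivlMr //.
apply: le_trans (_ : b ^+ 2 <= _); first by rewrite expr2 ler_wpM2l //; lra.
by apply: le_trans (ler_weXn2l b1 r1) _; rewrite lerDl.
Qed.

Lemma cseq_ge2 r a b n : (1 < r)%N -> 2 <= a -> a <= b -> 2 <= cseq r a b n.
Proof.
move=> r1; elim: n a b => //= n IH a b a2 ab; apply: IH; first by lra.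
by apply: cseq_step_ge => //; lra.
Qed.

Lemma cseq_half_ge2 r n : (1 < r)%N -> 2 <= cseq r (2^-1 : K) 1 n.+2.
Proof.
(* The sequence starts 1/2, 1, 4 and does not decrease afterwards. *)
move=> r1; have e : (1 ^+ r + 1) / 2^-1 = 4 :> K by rewrite expr1n invrK; lra.
rewrite /= e; apply: cseq_ge2 => //; first by lra.
by apply: cseq_step_ge => //; lra.
Qed.

(** The sequence starts 1, 1/2, [g], [h] with [1 <= g <= 2] and [h >= 4]. The index begins at 3
    because [g] is the value of the exceptional variable [(a ^+ r + 1) / b]. *)
Lemma cseq_half_rev_ge2 r n : (1 < r)%N -> 2 <= cseq r (1 : K) 2^-1 n.+3.
Proof.
move=> r1 /=; set g := (_ + 1) / 1; set h := (g ^+ r + 1) / _.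
have h0 : 0 <= 2^-1 :> K by rewrite invr_ge0.
have h1 : 2^-1 <= 1 :> K by rewrite invf_le1 // ler1n.
have g1 : 1 <= g by rewrite /g divr1 lerDr exprn_ge0.
have g2 : g <= 2 by rewrite /g divr1 [leRHS](_ : 2 = 1 + 1) // lerD2r exprn_ile1.
have h4 : 4 <= h.
  by have := exprn_ege1 r g1; rewrite /h invrK; lra.
apply: cseq_ge2 => //; first by lra.
by apply: cseq_step_ge => //; lra.
Qed.

End RealSequence.

Section Pentagon.
Variables (K : fieldType) (a b : K).
Hypotheses (a0 : a != 0) (b0 : b != 0) (a1 : a + 1 != 0) (b1 : b + 1 != 0).
Hypothesis ab1 : a + b + 1 != 0.

Lemma cseq1_4 : cseq 1 a b 4 = (a + 1) / b.
Proof. by rewrite /= !expr1; field; rewrite a0 b0 b1. Qed.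

(** The pentagon recurrence: [a], [b], [(b + 1) / a], [(a + b + 1) / (a * b)], [(a + 1) / b], then
    [a], [b] again. *)
Lemma cseq1_period n : cseq 1 a b n.+4.+1 = cseq 1 a b n.
Proof.
have ab1' : b + 1 + a != 0 by rewrite addrC addrA.
have ab1'' : b + 1 + a + a * b != 0.
  by rewrite (_ : _ + _ = (a + 1) * (b + 1)) ?mulf_neq0 //; ring.
by rewrite /= !expr1; congr (cseq _ _ _ n); field; rewrite ?a0 ?b0 ?a1 ?b1 ?ab1' ?ab1''.
Qed.

End Pentagon.

Section Dichotomy.
Variables (m : nat) (pt : 'I_m -> rat) (a b : ambient_field m).
Hypotheses (a_half : evaluates pt a 2^-1) (b_one : evaluates pt b 1).

Lemma cseq1_dichotomy n z : z = cseq 1 a b n \/ z = cseq 1 b a n ->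
  [\/ z = a, z = b, z = (a ^+ 1 + 1) / b | exists2 c, 2 <= c & evaluates pt z c].
Proof.
have a0 : a != 0 by apply: evaluates_neq0 a_half.
have b0 : b != 0 by apply: evaluates_neq0 b_one.
have a1 : a + 1 != 0 by apply: evaluates_neq0 (evaluatesD a_half (evaluates1 _)).
have b1 : b + 1 != 0 by apply: evaluates_neq0 (evaluatesD b_one (evaluates1 _)).
have ab1 : a + b + 1 != 0.
  by apply: evaluates_neq0 (evaluatesD (evaluatesD a_half b_one) (evaluates1 _)).
have ba1 : b + a + 1 != 0 by rewrite (addrC b).
have half0 : 0 < 2^-1 :> rat by [].
have Eab k := evaluates_cseq 1 k half0 ltr01 a_half b_one.
have Eba k := evaluates_cseq 1 k ltr01 half0 b_one a_half.
elim/ltn_ind: n => n IH.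
have [n5|n5] := leqP 5 n.
  by rewrite -(subnK n5) !addnS addn0 !cseq1_period //; apply: IH; lia.
(* One period has the values 1/2, 1, 4, 5, 3/2 from [a], [b] and 1, 1/2, 3/2, 5, 4 from [b], [a];
   3/2 belongs to the exceptional variable. *)
case: n n5 {IH} => [|[|[|[|[|//]]]]] _.
- by case=> ->; [constructor 1 | constructor 2].
- by case=> ->; [constructor 2 | constructor 1].
- by case=> ->; [constructor 4; exists (cseq 1 2^-1 1 2) | constructor 3].
- by case=> ->; constructor 4; [exists (cseq 1 2^-1 1 3) | exists (cseq 1 1 2^-1 3)].
- case=> ->; first by rewrite cseq1_4 //; constructor 3.
  by constructor 4; exists (cseq 1 1 2^-1 4).
Qed.

Lemma cseq_dichotomy r n z : (0 < r)%N -> z = cseq r a b n \/ z = cseq r b a n ->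
  [\/ z = a, z = b, z = (a ^+ r + 1) / b | exists2 c, 2 <= c & evaluates pt z c].
Proof.
case: r => [|[|r]] // _; first exact: cseq1_dichotomy.
case: n => [|[|n]]; first by case=> ->; [constructor 1 | constructor 2].
  by case=> ->; [constructor 2 | constructor 1].
case=> ->.
  constructor 4; exists (cseq r.+2 2^-1 1 n.+2); first exact: cseq_half_ge2.
  exact: evaluates_cseq.
case: n => [|n]; first by constructor 3.
constructor 4; exists (cseq r.+2 1 2^-1 n.+3); first exact: cseq_half_rev_ge2.
exact: evaluates_cseq.
Qed.

End Dichotomy.

(** * Seeds of rank two *)

Definition arrows r (k : 'I_2) : quiver 2 :=
  \matrix_(i, j) (if (i == k) && (j != k) then r else 0)%N.

Lemma ord2_cases (P : 'I_2 -> Prop) : P ord0 -> P ord_max -> forall k, P k.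
Proof.
move=> P0 P1 [[|[|//]] lt_k].
  by rewrite (_ : Ordinal _ = ord0) //; apply: val_inj.
by rewrite (_ : Ordinal _ = ord_max) //; apply: val_inj.
Qed.

Lemma ord2E (k i : 'I_2) : i = k \/ i = rev_ord k.
Proof.
by elim/ord2_cases: k; elim/ord2_cases: i;
  first [by left | by right; apply: val_inj].
Qed.

Lemma rev_ord2_neq (k : 'I_2) : (rev_ord k == k) = false.
Proof. by elim/ord2_cases: k. Qed.

Lemma big_ord2 (K : fieldType) (G : 'I_2 -> K) k :
  \prod_i G i = G k * G (rev_ord k).
Proof.
rewrite (bigD1 k) //= (bigD1 (rev_ord k)) ?rev_ord2_neq //=.
rewrite big1 ?mulr1 // => i /andP[ik].
by case: (ord2E k i) ik => ->; rewrite eqxx.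
Qed.

Lemma is_quiver2 (Q : quiver 2) :
  is_quiver Q -> exists r k, (0 < r)%N /\ Q = arrows r k.
Proof.
case/and3P=> /forallP loop /forallP cyc /forallP conn.
have Q0 k r : Q k (rev_ord k) = r -> Q (rev_ord k) k = 0%N -> Q = arrows r k.
  move=> Qr Qr'; apply/matrixP=> i j; rewrite mxE.
  by case: (ord2E k i) => ->; case: (ord2E k j) => ->;
    rewrite ?eqxx ?rev_ord2_neq //=; apply/eqP/loop.
have rev0 : rev_ord ord0 = ord_max :> 'I_2 by apply: val_inj.
have rev1 : rev_ord ord_max = ord0 :> 'I_2 by apply: val_inj.
have /orP[/eqP e|/eqP e] := forallP (cyc ord0) ord_max.
  exists (Q ord_max ord0), ord_max; split; last by apply: Q0; rewrite rev1.
  rewrite lt0n; apply/negP => /eqP e'.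
  (* Without arrows, a path between the two points could not make its first step away from
     [ord0]. *)
  move/forallP: (conn ord0) => /(_ ord_max)/connectP[[|x p] //= /andP[+ _] _].
  have /eqP := eqP (loop ord0).
  by elim/ord2_cases: x; rewrite ?e ?e' // => /eqP ->.
exists (Q ord0 ord_max), ord0; split; last by apply: Q0; rewrite rev0.
rewrite lt0n; apply/negP => /eqP e'.
move/forallP: (conn ord0) => /(_ ord_max)/connectP[[|x p] //= /andP[+ _] _].
have /eqP := eqP (loop ord0).
by elim/ord2_cases: x; rewrite ?e ?e' // => /eqP ->.
Qed.

(** No path of length two exists, so mutation at either point only reverses the arrows. *)
Lemma mutation_arrows r c k : quiver_mutation k (arrows r c) = arrows r (rev_ord c).
Proof.
apply/matrixP=> i j; rewrite !mxE.
by elim/ord2_cases: c; elim/ord2_cases: k; elim/ord2_cases: i; elim/ord2_cases: j;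
   rewrite /= ?muln0 ?mul0n ?addn0 ?subn0 ?sub0n.
Qed.

(** One of the two monomials is 1, so the orientation does not affect the exchange relation. *)
Lemma exchange_arrows (K : fieldType) (t : seed K 2) r c k :
  squiver t = arrows r c ->
  exchange_var k t = (svar t (rev_ord k) ^+ r + 1) / svar t k.
Proof.
move=> Qt; rewrite /exchange_var Qt !(big_ord2 _ k) !mxE.
case: (ord2E k c) => ->; rewrite ?eqxx ?rev_ord2_neq ?(eq_sym k) ?rev_ord2_neq /=.
  by rewrite !expr0 !mul1r addrC.
by rewrite !expr0 !mul1r.
Qed.

Section RankTwo.
Variables (K : fieldType) (r : nat).
Implicit Types t u : seed K 2.

Definition rank_two t := exists c, squiver t = arrows r c.

Lemma rank_two_mutation t k : rank_two t -> rank_two (mutation t k).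
Proof. by case=> c Qt; exists (rev_ord c); rewrite /= Qt mutation_arrows. Qed.

Lemma svar_mutation t k i : rank_two t ->
  svar (mutation t k) i =
    if i == k then (svar t (rev_ord k) ^+ r + 1) / svar t k else svar t i.
Proof. by case=> c Qt; rewrite ffunE (exchange_arrows _ Qt). Qed.

Lemma mutationK t k : rank_two t -> svar t k != 0 ->
  svar (mutation t k) k != 0 -> mutation (mutation t k) k = t.
Proof.
move=> t2; have [c Qt] := t2; rewrite svar_mutation // eqxx => tk0 tk1.
apply: seedP => [i|i j]; last first.
  by rewrite /= Qt !mutation_arrows rev_ordK.
rewrite svar_mutation; last exact: rank_two_mutation.
rewrite !svar_mutation // eqxx rev_ord2_neq.
case: eqP => [->|//]; rewrite invf_div mulrC divfK //.
by apply: contraNneq tk1 => ->; rewrite mul0r.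
Qed.
End RankTwo.

(** * Values on the seeds of a rank two mutation class *)

Section EvaluableSeeds.
Variables (r : nat).
Local Notation F := (ambient_field 2).
Implicit Types t u : seed F 2.

(* Mutations of positive rational values are invertible, so every positive
   choice of values for a cluster comes from a point. *)
Definition evaluable t := rank_two r t /\ forall c : 'I_2 -> rat,
  (forall i, 0 < c i) -> exists pt, forall i, evaluates pt (svar t i) (c i).

Lemma evaluable_initial k : evaluable (initial_seed (arrows r k)).
Proof.
split=> [|c _]; first by exists k.
exists c => i; rewrite ffunE -[X in evaluates _ _ X](mevalXU c).
exact: evaluates_tofrac.
Qed.

Lemma evaluable_mutation t k : evaluable t -> evaluable (mutation t k).
Proof.
case=> t2 tev; split=> [|c c0]; first exact: rank_two_mutation.
(* The value that the old variable at [k] must take for the new one to take the value [c k]. *)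
pose w := (c (rev_ord k) ^+ r + 1) / c k.
have w0 : 0 < w by rewrite divr_gt0 // addr_gt0 ?exprn_gt0.
have [|pt ev] := tev (fun i => if i == k then w else c i); first by move=> i; case: ifP.
exists pt => i; rewrite (svar_mutation _ _ t2).
have [->|ik] := eqVneq i k; last by have := ev i; rewrite (negPf ik).
have <- : (c (rev_ord k) ^+ r + 1) / w = c k.
  by rewrite /w invf_div mulrC divfK // gt_eqF // addr_gt0 ?exprn_gt0.
have := ev k; have := ev (rev_ord k); rewrite eqxx rev_ord2_neq => evk' evk.
apply: evaluatesM; last by apply: evaluatesV evk; rewrite gt_eqF.
exact: evaluatesD (evaluatesX _ evk') (evaluates1 _).
Qed.

Lemma evaluable_equiv t u : evaluable t -> mutation_equiv t u -> evaluable u.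
Proof.
move=> tev; apply: mutation_equiv_ind => // v k; exact: evaluable_mutation.
Qed.

Lemma evaluable_neq0 t i : evaluable t -> svar t i != 0.
Proof.
by case=> _ /(_ (fun=> 1))[|pt ev] //; apply: evaluates_neq0 (ev i).
Qed.

(** The variables are nonzero, hence each mutation is undone by repeating it. *)
Lemma evaluable_equiv_sym t u :
  evaluable t -> mutation_equiv t u -> mutation_equiv u t.
Proof.
move=> tev tu; apply: (proj2 (_ : evaluable u /\ _)).
elim/mutation_equiv_ind: u / tu => [|v k [vev vt]].
  by split=> //; apply: mutation_equiv_refl.
have vkev := evaluable_mutation k vev.
split=> //; apply: mutation_equiv_trans vt.
rewrite -{2}(mutationK (proj1 vev) (evaluable_neq0 k vev) (evaluable_neq0 k vkev)).
exact/mutation_equiv_mut/mutation_equiv_refl.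
Qed.

Lemma evaluable_half t k : evaluable t -> exists pt,
  evaluates pt (svar t k) 2^-1 /\ evaluates pt (svar t (rev_ord k)) 1.
Proof.
case=> _ /(_ (fun i => if i == k then 2^-1 else 1)) [i|pt ev]; first by case: ifP.
by exists pt; move: (ev k) (ev (rev_ord k)); rewrite eqxx rev_ord2_neq.
Qed.

Lemma evaluable_cseq_neq0 t k n :
  evaluable t -> cseq r (svar t k) (svar t (rev_ord k)) n != 0.
Proof.
move=> /(evaluable_half k)[pt [evk evk']].
have half0 : 0 < 2^-1 :> rat by [].
apply: evaluates_neq0 (evaluates_cseq r n half0 ltr01 evk evk').
by rewrite gt_eqF // cseq_gt0.
Qed.

Lemma evaluable_cseq_succ_neq0 t k n :
  evaluable t -> cseq r (svar t k) (svar t (rev_ord k)) n.+1 ^+ r + 1 != 0.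
Proof.
move=> tev; have := evaluable_cseq_neq0 k n.+2 tev.
by rewrite cseqSS; apply: contraNneq => ->; rewrite mul0r.
Qed.

(** Each cluster reached consists of two consecutive terms of the exchange sequence, run from the
    cluster of [t] in the direction given by [k]. *)
Lemma cluster_variable_cseq t z : evaluable t -> cluster_variable t z ->
  exists n k, z = cseq r (svar t k) (svar t (rev_ord k)) n.
Proof.
move=> tev [u tu /imfsetP[/= i _ ->]].
pose C k := cseq r (svar t k) (svar t (rev_ord k)).
have [n [k [j [uj uj']]]] : exists n k j,
    svar u j = C k n /\ svar u (rev_ord j) = C k n.+1.
  suff [] : evaluable u /\ exists n k j,
    svar u j = C k n /\ svar u (rev_ord j) = C k n.+1 by [].
  elim/mutation_equiv_ind: u / tu => [|u l [uev [n [k [j [uj uj']]]]]].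
    by split=> //; exists 0%N, ord0, ord0.
  split; first exact: evaluable_mutation.
  (* Mutating the earlier term moves the pair one step forward; mutating the later one moves it
     back. *)
  have [u2 _] := uev; have [->|->] := ord2E j l.
    exists n.+1, k, (rev_ord j); rewrite rev_ordK !(svar_mutation _ _ u2) eqxx.
    by rewrite rev_ord2_neq uj uj' -cseqSS.
  have jj' : (j == rev_ord j) = false by rewrite eq_sym rev_ord2_neq.
  (* Moving back from the start is a step forward in the opposite direction. *)
  case: n => [|n] in uj uj' *.
    exists 1%N, (rev_ord k), j; rewrite !(svar_mutation _ _ u2) eqxx jj' !rev_ordK uj uj'.
    by rewrite /C /= rev_ordK.
  exists n, k, (rev_ord j); rewrite !rev_ordK !(svar_mutation _ _ u2) eqxx jj'.
  rewrite !rev_ordK uj uj'; split=> //; rewrite /C cseqSS invf_div mulrC divfK //.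
  exact: evaluable_cseq_succ_neq0.
by case: (ord2E j i) => ->; rewrite ?uj ?uj'; [exists n | exists n.+1]; exists k.
Qed.

Lemma cluster_variable_dichotomy t z k pt : (0 < r)%N -> evaluable t ->
  let a := svar t k in let b := svar t (rev_ord k) in
  evaluates pt a 2^-1 -> evaluates pt b 1 -> cluster_variable t z ->
  [\/ z = a, z = b, z = (a ^+ r + 1) / b | exists2 c, 2 <= c & evaluates pt z c].
Proof.
move=> r0 tev a b eva evb /(cluster_variable_cseq tev)[n [l zE]].
apply: (cseq_dichotomy eva evb (n := n)) => //.
by move: zE; case: (ord2E k l) => ->; rewrite ?rev_ordK => ->; [left | right].
Qed.

End EvaluableSeeds.

(** * Identification of a competing seed of rank two *)

Section RankTwoIndependence.
Variables (n : nat) (y : 'I_2 -> ambient_field n).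
Hypothesis indep : alg_independent y.
Local Notation x := (y ord0).
Local Notation z := (y ord_max).
Local Notation ev := (mmap (@tofrac _ \o @mpolyC n rat) y).

(** A nonzero value at a single rational point thus refutes a polynomial relation between the
    [y i]. *)
Lemma alg_independent_meval (p : {mpoly rat[2]}) v : ev p = 0 -> p.@[v] = 0.
Proof. by rewrite -mmap_ratr => /indep ->; rewrite meval0. Qed.

Lemma ev_var i : ev 'X_i = y i.
Proof. by rewrite mmapX mmap1U. Qed.

Lemma independent_neq : x <> z.
Proof.
move=> xz; have := @alg_independent_meval ('X_ord0 - 'X_ord_max) (fun i => i%:R).
by rewrite rmorphB /= !ev_var mevalB !mevalXU xz subrr => /(_ erefl).
Qed.

(** At the origin the left side would be 0 and the right side 1. Hence an exchange in the competing
    seed never returns a variable of the same cluster. *)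
Lemma independent_mul_neq r u : (0 < r)%N -> u = x \/ u = z ->
  u * z <> x ^+ r + 1.
Proof.
case: r => // r _ xz uz.
have [i ui] : exists i, u = y i by case: xz => ->; [exists ord0 | exists ord_max].
have := @alg_independent_meval ('X_i * 'X_ord_max - 'X_ord0 ^+ r.+1 - 1) (fun=> 0).
rewrite !rmorphB !rmorphM !rmorphXn !rmorph1 /=.
rewrite !ev_var -ui uz [_ + 1]addrC addrK subrr => /(_ erefl).
by rewrite !mevalXU mul0r expr0n.
Qed.

Lemma independent_expr_inj r r' : x ^+ r = x ^+ r' -> r = r'.
Proof.
move=> xr; have := @alg_independent_meval ('X_ord0 ^+ r - 'X_ord0 ^+ r') (fun=> 2).
rewrite !rmorphB !rmorphXn /= !ev_var xr subrr => /(_ erefl).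
rewrite !mevalXU => /eqP; rewrite subr_eq0 -!natrX eqr_nat.
by move/eqP/expnI; apply.
Qed.

End RankTwoIndependence.

Lemma relabel_rank_two (K : fieldType) r (t u : seed K 2) k :
  rank_two r t -> rank_two r u ->
  svar u ord0 = svar t k -> svar u ord_max = svar t (rev_ord k) ->
  exists p b, u = relabel p b t.
Proof.
move=> [c Qt] [c' Qu] u0 u1.
pose f (i : 'I_2) := if i == ord0 then k else rev_ord k.
have f_inj : injective f.
  apply: (can_inj (g := fun j => if j == k then ord0 else ord_max)).
  by elim/ord2_cases; rewrite /f /= ?eqxx ?rev_ord2_neq.
(* Arrows are reversed exactly when [f] does not send the source in [u] to the source in [t]. *)
exists (perm f_inj), (f c' != c); apply: seedP => [|i j].
  by elim/ord2_cases; rewrite ffunE permE.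
rewrite /relabel /= Qu Qt !mxE !permE.
have [<-|] := eqVneq (f c') c; first by rewrite !(inj_eq f_inj).
by rewrite /f; elim/ord2_cases: k {u0 u1 f f_inj}; elim/ord2_cases: c {Qt};
   elim/ord2_cases: c' {Qu}; elim/ord2_cases: i; elim/ord2_cases: j.
Qed.

Section Clusters.
Variables (K : fieldType) (n : nat).
Implicit Types t u : seed K n.

Lemma cluster_variable_svar t u i : mutation_equiv t u -> cluster_variable t (svar u i).
Proof. by move=> tu; exists u => //; apply/imfsetP; exists i. Qed.

Lemma cluster_variable_trans t u z :
  mutation_equiv t u -> cluster_variable u z -> cluster_variable t z.
Proof. by move=> tu [v uv zv]; exists v => //; apply: mutation_equiv_trans uv. Qed.

End Clusters.

Lemma competing_rank_two r (s s' : seed (ambient_field 2) 2) :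
  (0 < r)%N -> evaluable r s -> is_seed s' ->
  (forall z, cluster_variable s' z -> cluster_variable s z) ->
  exists p b t, mutation_equiv s t /\ s' = relabel p b t.
Proof.
move=> r0 sev [indep /is_quiver2[r' [c' [r'0 Qs']]]] sub.
have s'2 : rank_two r' s' by exists c'.
set a := svar s' ord0; set y := svar s' ord_max.
have Xa : cluster_variable s a.
  exact/sub/cluster_variable_svar/mutation_equiv_refl.
have [t st /imfsetP[/= k _ ak]] := Xa.
have tev := evaluable_equiv sev st.
have ts := evaluable_equiv_sym sev st.
pose b := svar t (rev_ord k); pose b' := (a ^+ r + 1) / b.
have b0 : b != 0 by apply: evaluable_neq0 tev.
have [pt []] := evaluable_half k tev; rewrite -ak -/b => eva evb.
have sub' z : cluster_variable s' z ->
    [\/ z = a, z = b, z = b' | exists2 c, 2 <= c & evaluates pt z c].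
  move=> /sub/(cluster_variable_trans ts) Xz.
  by rewrite /b' ak; apply: cluster_variable_dichotomy Xz => //; rewrite -?ak.
(* Apart from [a], the values are 1 at [b], [2^-1 ^+ r + 1] at [b'] and at least 2 elsewhere. *)
have ge1 z : cluster_variable s' z -> z <> a -> exists2 d, 1 <= d & evaluates pt z d.
  move=> /sub'[->|->|->|[c c2 ec]] // _; first by exists 1.
    exists ((2^-1 ^+ r + 1) / 1).
      by rewrite divr1 lerDr exprn_ge0.
    apply: evaluatesM; last exact: evaluatesV evb.
    exact: evaluatesD (evaluatesX _ eva) (evaluates1 _).
  by exists c => //; apply: le_trans c2.
pose y' := (a ^+ r' + 1) / y.
have rev1 : rev_ord ord_max = ord0 :> 'I_2 by apply: val_inj.
have y'E : svar (mutation s' ord_max) ord_max = y'.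
  by rewrite (svar_mutation _ _ s'2) eqxx rev1.
have Xy : cluster_variable s' y by apply/cluster_variable_svar/mutation_equiv_refl.
have Xy' : cluster_variable s' y'.
  by rewrite -y'E; apply/cluster_variable_svar/mutation_equiv_mut/mutation_equiv_refl.
have y0 : y != 0.
  have [d d1 ed] := ge1 y Xy (fun e => independent_neq indep (esym e)).
  by apply: evaluates_neq0 ed; rewrite gt_eqF // (lt_le_trans _ d1).
have yy' : y' * y = a ^+ r' + 1 by rewrite divfK.
have y'a : y' <> a.
  by move=> e; apply: (independent_mul_neq indep r'0 (u := y')) yy'; left.
have y'y : y' <> y.
  by move=> e; apply: (independent_mul_neq indep r'0 (u := y')) yy'; right.
have ya : y <> a by move=> e; apply: (independent_neq indep).
(* If [z] had a value at least 2, so would [w * z], whereas [a ^+ r' + 1] has value at most 3/2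
   because [r' > 0]. *)
have small z w : cluster_variable s' z -> cluster_variable s' w -> z <> a -> w <> a ->
    w * z = a ^+ r' + 1 -> z = b \/ z = b'.
  move=> Xz Xw za wa wz; case: (sub' z Xz) => [//|->|->|[c c2 zc]]; [by left|by right|].
  have [d d1 wd] := ge1 w Xw wa.
  have := evaluates_inj (evaluatesM wd zc); rewrite wz.
  move=> /(_ _ (evaluatesD (evaluatesX r' eva) (evaluates1 _))) e.
  have h : 2^-1 ^+ r' <= 2^-1 :> rat.
    by case: (r') r'0 => // q _; rewrite exprS ler_piMr // exprn_ile1.
  have : 2 <= d * c by rewrite -[2]mul1r ler_pM.
  by rewrite e leNgt => /negP[]; apply: le_lt_trans (lerD h (lexx 1)) _.
have bb' : b' * b = a ^+ r + 1 by rewrite divfK.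
have yb := small y y' Xy Xy' ya y'a yy'.
have y'b : y' = b \/ y' = b' by apply: (small y' y) => //; rewrite mulrC.
have rr' : r = r'.
  apply: (independent_expr_inj indep); apply: (addIr 1); rewrite -yy' -bb'.
  by case: yb y'b y'y => -> [] -> // _; rewrite mulrC.
case: yb => [yb|yb].
  have [p [q s'E]] : exists p q, s' = relabel p q t.
    by apply: (relabel_rank_two (proj1 tev) (k := k)) => //; rewrite rr'.
  by exists p, q, t.
(* If [y] is [b'], the competing cluster is that of the mutation of [t] at the point carrying
   [b]. *)
have t2 := proj1 tev.
have [p [q s'E]] : exists p q, s' = relabel p q (mutation t (rev_ord k)).
  apply: (relabel_rank_two (rank_two_mutation (rev_ord k) t2) (k := k)).
  - by rewrite rr'.
  - by rewrite (svar_mutation _ _ t2) eq_sym rev_ord2_neq.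
  - by rewrite (svar_mutation _ _ t2) eqxx rev_ordK -ak.
by exists p, q, (mutation t (rev_ord k)); split=> //; apply: mutation_equiv_mut.
Qed.

(** * Competing seeds of other ranks, and conclusion *)

(** Both exchange monomials are 1, so mutation sends [x] to [2 / x], an involution. *)
Lemma cluster_variable_rank_one (K : fieldType) (s : seed K 1) z :
  2 != 0 :> K -> is_quiver (squiver s) -> cluster_variable s z ->
  z = svar s ord0 \/ z = 2 / svar s ord0.
Proof.
move=> two0 /and3P[/forallP/(_ ord0)/eqP Q0 _ _] [t st /imfsetP[/= i _ ->]].
rewrite (ord1 i) {i}; suff [] : squiver t ord0 ord0 = 0%N /\
  (svar t ord0 = svar s ord0 \/ svar t ord0 = 2 / svar s ord0) by [].
elim/mutation_equiv_ind: t / st => [|u k [Qu IH]]; first by split=> //; left.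
rewrite (ord1 k) {k}; split; first by rewrite !mxE eqxx /= Qu subnn.
rewrite ffunE eqxx /exchange_var !big_ord1 Qu expr0.
by case: IH => ->; [right | left; rewrite invf_div mulrC divfK].
Qed.

Lemma no_cluster_variable_rank_zero (K : fieldType) (s : seed K 0) z :
  ~ cluster_variable s z.
Proof. by case=> t _ /imfsetP[/= [i lt_i]]. Qed.

Theorem theorem5p4 (Q : quiver 2) (hQ : is_quiver Q) :
  unistructural (initial_seed Q).
Proof.
have [r [c [r0 QE]]] := is_quiver2 hQ.
have sev : evaluable r (initial_seed Q) by rewrite QE; apply: evaluable_initial.
move=> m s' s'seed _ sameX.
have X k : cluster_variable s' (svar (initial_seed Q) k).
  exact/sameX/cluster_variable_svar/mutation_equiv_refl.
case: m s' s'seed sameX X => [|[|[|m]]] s' s'seed sameX X.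
- by case: (no_cluster_variable_rank_zero (X ord0)).
(* Two distinct cluster variables in rank one multiply to 2; the initial variables, given the values
   1 and 3, are distinct but do not. *)
- exfalso; pose w (k : 'I_2) : rat := if k == ord0 then 1 else 3.
  have [k|pt ev] := proj2 sev w; first by rewrite /w; case: ifP.
  have two : evaluates pt 2 2 := evaluatesD (evaluates1 _) (evaluates1 _).
  have two0 : 2 != 0 :> ambient_field 2 by apply: evaluates_neq0 two.
  have Xk k := cluster_variable_rank_one two0 (proj2 s'seed) (X k).
  have ne : svar (initial_seed Q) ord0 <> svar (initial_seed Q) ord_max.
    by move=> e; have := evaluates_inj (ev ord0); rewrite e => /(_ _ (ev ord_max)).
  have n2 : svar (initial_seed Q) ord0 * svar (initial_seed Q) ord_max <> 2.
    by move=> e; have := evaluates_inj (evaluatesM (ev ord0) (ev ord_max));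
      rewrite e => /(_ _ two).
  (* As the inverse of 0 is 0, a zero variable would make both initial variables 0, hence equal. *)
  have s0 : svar s' ord0 != 0.
    by apply/eqP=> s0; move: (Xk ord0) (Xk ord_max) ne; rewrite s0 invr0 mulr0;
      case=> ->; case=> ->.
  case: (Xk ord0) (Xk ord_max) ne n2 => -> [] -> ne n2; try exact: ne.
    by apply: n2; rewrite mulrC divfK.
  by apply: n2; rewrite divfK.
- have [p [b [t [st ->]]]] := competing_rank_two r0 sev s'seed (fun z => (sameX z).2).
  exists (relabel p b); first exact/relabel_iso/(evaluable_equiv_sym sev).
  by move=> u _; rewrite relabel_cluster.
- by case: (not_alg_independent _ (proj1 s'seed)).
Qed.
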